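(* Let $\mathcal H$ be a separable Hilbert space. Assume that $\{T^n\varphi\}_{n=0}^\infty$ is a frame for $\mathcal H$ for some bounded linear operator $T:\mathcal H\to\mathcal H$ and some $\varphi\in\mathcal H$, and let $A>0$ denote a lower frame bound. Assume that $V\subset\mathcal H$ is invariant under $T$ and that there exists $\mu\in[0,1)$ such that $\|T\widetilde\varphi\|\le\mu\|\widetilde\varphi\|$ for all $\widetilde\varphi\in V$. Then the following hold: (i) $\{T^n(\varphi+\widetilde\varphi)\}_{n=0}^\infty$ is a frame sequence for all $\widetilde\varphi\in V$. (ii) $\{T^n(\varphi+\widetilde\varphi)\}_{n=0}^\infty$ is a frame for $\mathcal H$ for all $\widetilde\varphi\in V$ for which $\|\widetilde\varphi\|<\sqrt{A(1-\mu^2)}$.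
   Context: A sequence $\{f_k\}$ in a Hilbert space $\mathcal K$ is a frame for $\mathcal K$ if there exist constants $A,B>0$ such that $A\|f\|^2\le\sum_k|\langle f,f_k\rangle|^2\le B\|f\|^2$ for all $f\in\mathcal K$; any such $A$ is called a lower frame bound. A frame sequence in $\mathcal H$ is a sequence that is a frame for its closed linear span. Invariance of $V$ under $T$ means $T(V)\subseteq V$. *)

(* Defs.v *)
From HB Require Import structures.
From mathcomp Require Import all_boot all_order all_algebra.
From mathcomp Require Import sesquilinear.
From mathcomp Require Import complex.
From mathcomp Require Import all_classical all_reals all_analysis.

Set Implicit Arguments.
Unset Strict Implicit.
Unset Printing Implicit Defensive.

Import Order.TTheory GRing.Theory Num.Theory.
Import numFieldNormedType.Exports.

Local Open Scope classical_set_scope.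
Local Open Scope ring_scope.

(* Hilbert spaces are real or complex: the scalar field is R or R[i]. *)
Variant scalar_kind := RealScalars | ComplexScalars.

Definition scalar_field (R : realType) (s : scalar_kind) : numFieldType :=
  match s with
  | RealScalars => R : numFieldType
  | ComplexScalars => complex R : numFieldType
  end.

Definition scalar_conj (R : realType) (s : scalar_kind) :
    {rmorphism scalar_field R s -> scalar_field R s} :=
  match s return {rmorphism scalar_field R s -> scalar_field R s} with
  | RealScalars => GRing.RMorphism.clone R R idfun _
  | ComplexScalars => GRing.RMorphism.clone (complex R) (complex R) Num.conj _
  end.

Definition scalar_re (R : realType) (s : scalar_kind) :
    scalar_field R s -> R :=
  match s return scalar_field R s -> R with
  | RealScalars => fun x => x
  | ComplexScalars => @complex.Re R
  end.

(* The norm `|x| of a normed module lies in the scalar field, where it is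
   nonnegative; rnorm x is the same number as an element of R. It also applies
   to scalars, the field being a normed module over itself. *)
Definition rnorm (R : realType) (s : scalar_kind)
    (E : normedZmodType (scalar_field R s)) (x : E) : R :=
  scalar_re `|x|.

Definition separable (T : topologicalType) : Prop :=
  exists2 D : set T, countable D & dense D.

Definition bounded_operator (R : realType) (s : scalar_kind)
    (E F : normedModType (scalar_field R s)) (T : E -> F) : Prop :=
  exists M : R, forall x : E, rnorm (T x) <= M * rnorm x.

Section Frames.
Context (R : realType) (s : scalar_kind).
Context (H : normedModType (scalar_field R s)).
Context (dot : {dot H for scalar_conj R s}).

(* Sum of a nonnegative series, with value +oo when it diverges. *)
Definition frame_sum (f : nat -> H) (x : H) : \bar R :=
  (\sum_(0 <= k <oo) (rnorm (dot x (f k)) ^+ 2)%:E)%E.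

Definition lower_frame_bound (K : set H) (f : nat -> H) (A : R) : Prop :=
  0 < A /\
  forall x, K x -> ((A * rnorm x ^+ 2)%:E <= frame_sum f x)%E.

Definition upper_frame_bound (K : set H) (f : nat -> H) (B : R) : Prop :=
  0 < B /\
  forall x, K x -> (frame_sum f x <= (B * rnorm x ^+ 2)%:E)%E.

(* Here K stands for a closed subspace of H, a Hilbert space in its own right;
   the terms of a frame for K have to lie in K. *)
Definition frame (K : set H) (f : nat -> H) : Prop :=
  (forall k, K (f k)) /\
  exists A B : R, lower_frame_bound K f A /\ upper_frame_bound K f B.

Definition linear_span (f : nat -> H) : set H :=
  [set x | exists n (c : 'I_n -> scalar_field R s),
             x = \sum_(i < n) c i *: f i].

Definition frame_sequence (f : nat -> H) : Prop :=
  frame (closure (linear_span f)) f.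

End Frames.

(* Main.v *)
Require Import Defs.
From HB Require Import structures.
From mathcomp Require Import all_boot all_order all_algebra.
From mathcomp Require Import sesquilinear complex.
From mathcomp Require Import ring lra.
From mathcomp Require Import all_classical all_reals all_analysis.
Import Order.TTheory GRing.Theory Num.Theory.
Import numFieldNormedType.Exports.
Local Open Scope classical_set_scope.
Local Open Scope ring_scope.

(** Write [S f x] for the sum of the squares [|<x, f k>|^2]. The sequence in
    question is [g = f + h] with [f k = T^k phi] and [h k = T^k psi], and the
    contraction property, propagated by the invariance of [V], gives
    [|h k| <= mu^k |psi|]. By Cauchy-Schwarz, [S h x <= C |x|^2] with
    [C = |psi|^2 / (1 - mu^2)], and the tails of [S h] are small multiples of
    [|x|^2] ([geometric_frame_sum_le], [geometric_vanishing_tails]).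

    Since [f = g - h], convexity of the square gives
    [A |x|^2 <= S f x <= S g x / (1 - t) + S h x / t] for all [0 < t < 1]. If
    [C < A], which is the norm condition on [psi] in the second claim, a
    suitable [t] yields a lower frame bound for [g]
    ([frame_small_perturbation]).

    Without that condition only a tail of [S h] can be absorbed, and
    [S g x] plus finitely many squares [|<x, h k>|^2] is bounded below by a
    multiple of [|x|^2]. On the closed span of [g] the form [S g] is positive
    definite, and a positive definite form that becomes bounded below after
    adding finitely many squares of bounded functionals is already bounded
    below ([bounded_below_drop_functionals]); this is the finite-rank case of
    the stability of closed range under compact perturbation, and it rests
    on completeness. Hence [g] is a frame for its closed span
    ([frame_sequence_perturbation]). *)

Set Implicit Arguments.
Unset Strict Implicit.
Unset Printing Implicit Defensive.

(** * Scalars and real-valued norms *)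

(** Packaged as a ring morphism chosen by the scalar kind, so that the two
    cases are told apart only in the first few lemmas; everything after them
    is uniform in the scalar field. *)
Definition of_real (R : realType) (s : scalar_kind) :
    {rmorphism R -> scalar_field R s} :=
  match s return {rmorphism R -> scalar_field R s} with
  | RealScalars => GRing.RMorphism.clone R R idfun _
  | ComplexScalars => GRing.RMorphism.clone R (complex R) (real_complex R) _
  end.

Section Scalars.
Context (R : realType) (s : scalar_kind).
Notation K := (scalar_field R s).
Notation ofR := (of_real R s).

Lemma of_realK (r : R) : scalar_re (ofR r) = r.
Proof. by case: s. Qed.

Lemma ler_of_real (r r' : R) : (ofR r <= ofR r') = (r <= r').
Proof. by case: s => //=; rewrite lecR. Qed.

Lemma scalar_reK (z : K) : 0 <= z -> ofR (scalar_re z) = z.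
Proof.
move: z; case: s => //= -[a b].
by rewrite lecE /= => /andP[/eqP -> _].
Qed.

Lemma mul_scalar_conj (z : K) : z * scalar_conj R s z = `|z| ^+ 2.
Proof.
move: z; case: s => /= z; first by rewrite real_normK ?num_real// expr2.
by rewrite normCK.
Qed.

Lemma ltr_of_real (r r' : R) : (ofR r < ofR r') = (r < r').
Proof. by rewrite !lt_def ler_of_real (inj_eq (can_inj of_realK)). Qed.

Section Norm.
Context (E : normedZmodType K).
Implicit Types (x y : E).

Lemma of_real_rnorm x : ofR (rnorm x) = `|x|.
Proof. by rewrite /rnorm scalar_reK. Qed.

Lemma rnorm_ge0 x : 0 <= rnorm x.
Proof. by rewrite -ler_of_real of_real_rnorm rmorph0. Qed.

Lemma ler_rnormD x y : rnorm (x + y) <= rnorm x + rnorm y.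
Proof. by rewrite -ler_of_real rmorphD /= !of_real_rnorm ler_normD. Qed.

Lemma rnormN x : rnorm (- x) = rnorm x.
Proof. by rewrite /rnorm normrN. Qed.

Lemma ler_rnormB x y : rnorm (x - y) <= rnorm x + rnorm y.
Proof. by rewrite -(rnormN y) ler_rnormD. Qed.

Lemma rnorm0 : rnorm (0 : E) = 0.
Proof. by rewrite /rnorm normr0 -(rmorph0 ofR) of_realK. Qed.

Lemma rnorm0_eq0 x : rnorm x = 0 -> x = 0.
Proof.
by move=> x0; apply/normr0_eq0; rewrite -of_real_rnorm x0 rmorph0.
Qed.

End Norm.

Lemma rnorm1 : rnorm (1 : K) = 1.
Proof. by rewrite /rnorm normr1 -(rmorph1 ofR) of_realK. Qed.

Lemma rnormM (a b : K) : rnorm (a * b) = rnorm a * rnorm b.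
Proof.
by apply: (can_inj of_realK); rewrite rmorphM /= !of_real_rnorm normrM.
Qed.

(** Balls of a normed module have radii in the scalar field; this brings the
    radius back to a real number. *)
Lemma closure_rnormP (E : normedModType K) (M : set E) (x : E) : closure M x ->
  forall e : R, 0 < e -> exists2 y, M y & rnorm (x - y) < e.
Proof.
move=> Mx e e0.
have e0' : 0 < ofR e by rewrite -(rmorph0 ofR) ltr_of_real.
have [y [My]] := Mx _ (nbhsx_ballx x _ e0').
rewrite -ball_normE /= -of_real_rnorm ltr_of_real => ?.
by exists y.
Qed.

(** Completeness, with real radii and without filters. *)
Lemma rnorm_cauchy_cvg (E : completeNormedModType K) (y : nat -> E) :
  (forall e : R, 0 < e -> exists N, forall m n, (N <= m)%N -> (N <= n)%N ->
     rnorm (y m - y n) < e) ->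
  exists l, forall e : R, 0 < e -> exists N, forall n, (N <= n)%N ->
     rnorm (l - y n) < e.
Proof.
move=> cy.
have : cvg (y @ \oo).
  apply/cauchy_cvgP; apply/cauchy_ballP => e e0; near_simpl.
  have eE := scalar_reK (ltW e0).
  have [|N HN] := cy (scalar_re e).
    by rewrite -ltr_of_real eE rmorph0.
  exists ([set n | (N <= n)%N], [set n | (N <= n)%N]) => /=.
    by split; exists N.
  move=> [m n] /= [mN nN]; rewrite -ball_normE /= -eE -of_real_rnorm.
  by rewrite ltr_of_real; exact: HN.
move=> cvy; exists (lim (y @ \oo)) => e e0.
have e0' : 0 < ofR e by rewrite -(rmorph0 ofR) ltr_of_real.
have /cvgrPdist_lt/(_ _ e0')[N _ HN] := cvy.
exists N => n Nn; rewrite -ltr_of_real of_real_rnorm.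
exact: HN.
Qed.

End Scalars.

(** * Square-summable series *)

Section Series.
Context (R : realType).
Implicit Types (a b c : nat -> R).
Local Notation sum2 a := (\sum_(0 <= k <oo) (a k ^+ 2)%:E)%E.

(** The square is convex and [u + v] is the convex combination of [u / (1 - t)]
    and [v / t] with weights [1 - t] and [t]. *)
Lemma sqrD_le_convex (t u v w : R) : 0 < t < 1 -> 0 <= w -> w <= u + v ->
  w ^+ 2 <= (1 - t)^-1 * u ^+ 2 + t^-1 * v ^+ 2.
Proof.
move=> /andP[t0 t1] w0 wuv.
have -> : (1 - t)^-1 * u ^+ 2 + t^-1 * v ^+ 2 =
    (u + v) ^+ 2 + (t * u - (1 - t) * v) ^+ 2 / (t * (1 - t)).
  by field; apply/andP; split; lra.
rewrite (le_trans (y := (u + v) ^+ 2))//.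
  by rewrite lerXn2r// nnegrE (le_trans w0).
by rewrite lerDl divr_ge0 ?sqr_ge0// mulr_ge0//; lra.
Qed.

Lemma sqr_series_le_convex (t : R) a b c : 0 < t < 1 ->
  (forall k, 0 <= a k) -> (forall k, a k <= b k + c k) ->
  (sum2 a <= ((1 - t)^-1)%:E * sum2 b + (t^-1)%:E * sum2 c)%E.
Proof.
move=> /andP[t0 t1] a0 abc.
have sq0 (u : nat -> R) k : (0 <= (u k ^+ 2)%:E)%E by rewrite lee_fin sqr_ge0.
rewrite -!nneseriesZl// -nneseriesD//; last 2 first.
- by move=> k _ _; rewrite mule_ge0// lee_fin invr_ge0; lra.
- by move=> k _ _; rewrite mule_ge0// lee_fin invr_ge0; lra.
apply: lee_nneseries => // k _.
by rewrite -!EFinM -EFinD lee_fin; apply: sqrD_le_convex => //; rewrite t0.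
Qed.

Lemma sqr_series_le a (C : R) :
  (forall n, \sum_(0 <= k < n) a k ^+ 2 <= C) -> (sum2 a <= C%:E)%E.
Proof.
move=> aC; apply: lime_le.
  by apply: is_cvg_nneseries => k _ _; rewrite lee_fin sqr_ge0.
by apply: nearW => n; rewrite sumEFin lee_fin.
Qed.

Lemma sqr_geometric_le (mu r : R) n m : 0 <= mu < 1 -> (m <= n)%N ->
  \sum_(m <= k < n) (mu ^+ k * r) ^+ 2 <=
    (mu ^+ m) ^+ 2 * (r ^+ 2 / (1 - mu ^+ 2)).
Proof.
move=> /andP[mu0 mu1] mn.
have d0 : 0 < 1 - mu ^+ 2 by rewrite subr_gt0 expr_lt1.
suff -> : \sum_(m <= k < n) (mu ^+ k * r) ^+ 2 =
    ((mu ^+ m) ^+ 2 - (mu ^+ n) ^+ 2) * (r ^+ 2 / (1 - mu ^+ 2)).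
  by rewrite ler_wpM2r ?(divr_ge0 _ (ltW d0)) ?sqr_ge0// lerBlDr lerDl sqr_ge0.
rewrite -(subnKC mn); elim: (n - m)%N => [|j IH].
  by rewrite addn0 big_geq// subrr mul0r.
rewrite addnS big_nat_recr ?leq_addr//= IH (exprS mu (m + j)).
by field; rewrite gt_eqF.
Qed.

End Series.

(** * Inner products and orthogonal complements *)

Section InnerProduct.
Context (R : realType) (s : scalar_kind).
Notation K := (scalar_field R s).
Notation ofR := (of_real R s).
Context (H : normedModType K) (dot : {dot H for scalar_conj R s}).
Context (norm_dot : forall x : H, `|x| ^+ 2 = dot x x).

Lemma dot_conj x y : scalar_conj R s (dot y x) = dot x y.
Proof. by rewrite (hermC dot x y) expr0 mul1r. Qed.

Lemma dotDl x y z : dot (x + y) z = dot x z + dot y z.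
Proof. exact: linearDl. Qed.

Lemma dotDr x y z : dot x (y + z) = dot x y + dot x z.
Proof. exact: linearDr. Qed.

Lemma dotBl x y z : dot (x - y) z = dot x z - dot y z.
Proof. exact: linearBl. Qed.

Lemma dotZl a x y : dot (a *: x) y = a * dot x y.
Proof. exact: linearZl_LR. Qed.

Lemma dotZr a x y : dot x (a *: y) = scalar_conj R s a * dot x y.
Proof. exact: linearZr_LR. Qed.

(** The squared norm of [x - a y] is nonnegative; with [a = <x, y> / |y|^2],
    the coefficient of the orthogonal projection onto the line of [y], it
    equals [|x|^2 - |<x, y>|^2 / |y|^2]. *)
Lemma cauchy_schwarz x y : rnorm (dot x y) <= rnorm x * rnorm y.
Proof.
have [->|y0] := eqVneq y 0.
  by rewrite linear0r rnorm0 mulr_ge0// rnorm_ge0.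
rewrite -(ler_of_real s) rmorphM /= !of_real_rnorm.
rewrite -(ler_pXn2r (n := 2))// ?nnegrE ?mulr_ge0// exprMn.
have ny0 : 0 < `|y| ^+ 2 by rewrite exprn_gt0// normr_gt0.
rewrite -ler_pdivrMr// -subr_ge0.
set a := dot x y / `|y| ^+ 2.
suff -> : `|x| ^+ 2 - `|dot x y| ^+ 2 / `|y| ^+ 2 = `|x - a *: y| ^+ 2.
  by rewrite exprn_ge0.
have cy : scalar_conj R s (`|y| ^+ 2) = `|y| ^+ 2.
  by rewrite norm_dot dot_conj.
have ca : scalar_conj R s a = scalar_conj R s (dot x y) / `|y| ^+ 2.
  by rewrite rmorphM /= fmorphV /= cy.
rewrite [RHS]norm_dot dotBl !linearBr /= !dotZl !dotZr ca -!norm_dot.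
rewrite -(dot_conj y x) /a -mul_scalar_conj.
by rewrite divfK ?gt_eqF// subrr subr0 [X in _ = _ - X]mulrC mulrA.
Qed.

Lemma sqr_cauchy_schwarz x y :
  rnorm (dot x y) ^+ 2 <= rnorm y ^+ 2 * rnorm x ^+ 2.
Proof.
rewrite -exprMn lerXn2r ?nnegrE ?mulr_ge0 ?rnorm_ge0//.
by rewrite mulrC cauchy_schwarz.
Qed.

Definition dot_perp (S : set H) : set H :=
  [set x | forall z, S z -> dot x z = 0].

Lemma dot_perpB S x y : dot_perp S x -> dot_perp S y -> dot_perp S (x - y).
Proof. by move=> Sx Sy z Sz; rewrite dotBl Sx// Sy// subrr. Qed.

Lemma dot_perpZ S a x : dot_perp S x -> dot_perp S (a *: x).
Proof. by move=> Sx z Sz; rewrite dotZl Sx// mulr0. Qed.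

Lemma dot_perp_approx S x :
  (forall e : R, 0 < e -> exists2 y, dot_perp S y & rnorm (x - y) < e) ->
  dot_perp S x.
Proof.
move=> Sx z Sz; apply/(@rnorm0_eq0 R s)/le_anti; rewrite rnorm_ge0 andbT.
apply/unstable.ler_gtP => e e0.
have d0 : 0 < rnorm z + 1 by rewrite ltr_wpDl ?rnorm_ge0.
have [|y Sy xy] := Sx (e / (rnorm z + 1)); first by rewrite divr_gt0.
have -> : dot x z = dot (x - y) z by rewrite dotBl (Sy _ Sz) subr0.
rewrite (le_trans (cauchy_schwarz _ _))//.
rewrite (le_trans (y := e / (rnorm z + 1) * (rnorm z + 1)))//.
  by rewrite ler_pM ?rnorm_ge0 ?(ltW xy)// lerDl.
by rewrite divfK// gt_eqF.
Qed.

(** An orthogonal complement is a closed subspace, so it contains the closed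
    span of [f] as soon as it contains the vectors [f k]. This supplies a
    closed subspace around the span without making the closure itself into
    one. *)
Lemma closure_span_perp (f : nat -> H) (S : set H) x :
  (forall z, S z -> forall k, dot z (f k) = 0) ->
  closure (linear_span f) x -> dot_perp S x.
Proof.
move=> Sf fx; apply: dot_perp_approx => e e0.
have [y [n [c ->]] xy] := closure_rnormP fx e0.
exists (\sum_(i < n) c i *: f i) => // z Sz.
rewrite -dot_conj raddf_sum big1 ?rmorph0// => i _.
by rewrite /= dotZr Sf// mulr0.
Qed.

End InnerProduct.

(** * Lower bounds modulo finitely many functionals *)

(** The properties of the square of a bounded seminorm that are used below. The
    weak additivity with constant 2 replaces the triangle inequality, so that
    sums of such squares remain in the class without Minkowski's inequality. *)
Record square_seminorm (R : realType) (s : scalar_kind)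
    (H : normedModType (scalar_field R s)) (q : H -> R) : Prop :=
  SquareSeminorm {
    sqsem_ge0 : forall x, 0 <= q x;
    sqsem_add : forall x y, q (x + y) <= 2 * q x + 2 * q y;
    sqsem_scale : forall a x, q (a *: x) = rnorm a ^+ 2 * q x;
    sqsem_bound : exists2 B, 0 <= B & forall x, q x <= B * rnorm x ^+ 2
  }.

Record closed_subspace (R : realType) (s : scalar_kind)
    (H : normedModType (scalar_field R s)) (M : set H) : Prop :=
  ClosedSubspace {
    csub_sub : forall x y, M x -> M y -> M (x - y);
    csub_scale : forall a x, M x -> M (a *: x);
    csub_approx : forall x,
      (forall e : R, 0 < e -> exists2 y, M y & rnorm (x - y) < e) -> M x
  }.

Section DropFunctionals.
Context (R : realType) (s : scalar_kind).
Notation K := (scalar_field R s).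
Context (H : completeNormedModType K) (dot : {dot H for scalar_conj R s}).
Context (norm_dot : forall x : H, `|x| ^+ 2 = dot x x).

Lemma square_seminorm_dot z : square_seminorm (fun x => rnorm (dot x z) ^+ 2).
Proof.
split=> [x|x y|a x|].
- exact: sqr_ge0.
- have := @sqrD_le_convex R (2^-1) (rnorm (dot x z)) (rnorm (dot y z))
    (rnorm (dot (x + y) z)).
  have -> : 1 - 2^-1 = 2^-1 :> R by lra.
  rewrite invrK; apply; [by lra| exact: rnorm_ge0 |].
  by rewrite dotDl ler_rnormD.
- by rewrite dotZl rnormM exprMn.
- exists (rnorm z ^+ 2) => [|x]; first exact: sqr_ge0.
  exact: sqr_cauchy_schwarz.
Qed.

Lemma square_seminormD (p q : H -> R) :
  square_seminorm p -> square_seminorm q ->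
  square_seminorm (fun x => p x + q x).
Proof.
move=> [p0 pD pZ [B B0 pB]] [q0 qD qZ [C C0 qC]]; split=> [x|x y|a x|].
- by rewrite addr_ge0.
- by have := pD x y; have := qD x y; lra.
- by rewrite pZ qZ mulrDr.
- by exists (B + C) => [|x]; rewrite ?addr_ge0// mulrDl lerD.
Qed.

Lemma square_seminorm_sub (q : H -> R) x y : square_seminorm q ->
  q (x - y) <= 2 * q x + 2 * q y.
Proof.
move=> sq; have := sqsem_add sq x (- y).
by rewrite -(scaleN1r y) (sqsem_scale sq) rnormN rnorm1 expr1n mul1r.
Qed.

(** Were [q] not bounded below on [M], there would be nonzero [x] in [M] with
    [q x] arbitrarily small compared with [|x|^2]. The hypothesis then forces
    [<x, z>] to be comparable to [|x|], and dividing by it gives vectors [y k]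
    in [M] with [<y k, z> = 1] and [q (y k) <= 1 / (k + 1)]. On their
    differences the extra term [|<_, z>|^2] vanishes, so the hypothesis bounds
    the norm of a difference by [q] alone: the sequence is Cauchy. Its limit
    lies in [M], is annihilated by [q], hence is zero, and yet has product 1
    with [z]. *)
Lemma bounded_below_drop_functional (M : set H) (q : H -> R) (z : H) (c : R) :
  closed_subspace M -> square_seminorm q ->
  (forall x, M x -> q x = 0 -> x = 0) ->
  0 < c -> (forall x, M x -> c * rnorm x ^+ 2 <= q x + rnorm (dot x z) ^+ 2) ->
  exists2 c', 0 < c' & forall x, M x -> c' * rnorm x ^+ 2 <= q x.
Proof.
move=> csM sq q_inj c0 cM; apply: contrapT => nobound.
have [B B0 qB] := sqsem_bound sq.
have yk (k : nat) :
    exists y : H, [/\ M y, dot y z = 1 & q y <= k.+1%:R^-1].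
  have k0 : 0 < (k.+1%:R^-1 : R) by rewrite invr_gt0.
  have k1 : (k.+1%:R^-1 : R) <= 1 by rewrite invf_le1// ler1n.
  (* c / 2 leaves half of c |x|^2 to the functional; the remaining factor
     gives q (y k) <= 1 / (k + 1) after normalization. *)
  set d := c / 2 * k.+1%:R^-1.
  have d0 : 0 < d by rewrite mulr_gt0// divr_gt0.
  have [x Mx qx] : exists2 x, M x & q x < d * rnorm x ^+ 2.
    apply: contrapT => nx; apply: nobound; exists d => // x Mx.
    by rewrite leNgt; apply/negP => qx; apply: nx; exists x.
  have x0 : 0 < rnorm x ^+ 2.
    rewrite lt_def sqr_ge0 andbT; apply: contraTneq qx => ->.
    by rewrite mulr0 -leNgt sqsem_ge0.
  have Lx : c / 2 * rnorm x ^+ 2 < rnorm (dot x z) ^+ 2.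
    have := cM _ Mx.
    suff : d * rnorm x ^+ 2 <= c / 2 * rnorm x ^+ 2 by lra.
    by rewrite ler_wpM2r ?sqr_ge0// /d -[leRHS]mulr1 ler_wpM2l// ltW// divr_gt0.
  have Lx0 : 0 < rnorm (dot x z) ^+ 2.
    by rewrite (le_lt_trans _ Lx)// mulr_ge0 ?sqr_ge0// divr_ge0// ltW.
  have Lxn0 : dot x z != 0.
    by apply: contraTneq Lx0 => ->; rewrite rnorm0 expr0n ltxx.
  exists ((dot x z)^-1 *: x); split.
  - exact: csub_scale.
  - by rewrite dotZl mulVf.
  - have rV : rnorm (dot x z)^-1 ^+ 2 * rnorm (dot x z) ^+ 2 = 1.
      by rewrite -exprMn -rnormM mulVf// rnorm1 expr1n.
    rewrite (sqsem_scale sq) -(ler_pM2l Lx0) mulrA [X in X * _]mulrC rV mul1r.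
    rewrite (le_trans (ltW qx))// /d mulrAC ler_wpM2r// ?ltW//.
have [y yP] := choice yk.
have [l lP] : exists l, forall e : R, 0 < e -> exists N, forall n, (N <= n)%N ->
     rnorm (l - y n) < e.
  apply: rnorm_cauchy_cvg => e e0.
  have ce0 : 0 < c * e ^+ 2 / 4 by rewrite divr_gt0// mulr_gt0// exprn_gt0.
  have [N] := ltr_add_invr ce0; rewrite add0r => HN.
  exists N => m n Nm Nn.
  rewrite -(ltr_pXn2r (n := 2))// ?nnegrE ?rnorm_ge0 ?ltW//.
  have [Mm Lm qm] := yP m; have [Mn Ln qn] := yP n.
  have := cM _ (csub_sub csM Mm Mn).
  rewrite dotBl Lm Ln subrr rnorm0 expr0n addr0.
  have le1 k : (N <= k)%N -> (k.+1%:R^-1 : R) <= N.+1%:R^-1.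
    by move=> Nk; rewrite lef_pV2 ?posrE ?ler_nat.
  have := square_seminorm_sub (y m) (y n) sq.
  have := le1 _ Nm; have := le1 _ Nn.
  move: HN qm qn; rewrite -[(rnorm _ ^+ 2 < _)%R](ltr_pM2l c0).
  move: (q (y m - y n)) (q (y m)) (q (y n)) (_ ^+ 2) (e ^+ 2).
  move: (N.+1%:R^-1) (m.+1%:R^-1) (n.+1%:R^-1) => t tm tn qd qm' qn' X E.
  by lra.
have Ml : M l.
  apply: csub_approx => // e /lP[N HN].
  by exists (y N); [have [] := yP N | exact: HN].
have ql : q l = 0.
  apply/le_anti; rewrite sqsem_ge0// andbT; apply/unstable.ler_gtP => e e0.
  have B1 : 0 < B + 1 by rewrite ltr_wpDl.
  have d0 : 0 < e / (4 * (B + 1)) by rewrite divr_gt0// mulr_gt0.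
  have e0' : 0 < Num.sqrt (e / (4 * (B + 1))).
    by rewrite sqrtr_gt0.
  have [N1 HN1] := lP _ e0'.
  have e40 : 0 < e / 4 by rewrite divr_gt0.
  have [N2] := ltr_add_invr e40; rewrite add0r => HN2.
  set n := maxn N1 N2.
  have [_ _ qn] := yP n.
  have ln := HN1 n (leq_maxl _ _).
  have lnB : rnorm (l - y n) ^+ 2 <= e / (4 * (B + 1)).
    rewrite -(sqr_sqrtr (ltW d0)).
    by rewrite lerXn2r ?nnegrE ?rnorm_ge0 ?sqrtr_ge0// ltW.
  have e4 : (n.+1%:R^-1 : R) <= e / 4.
    rewrite (le_trans _ (ltW HN2))// lef_pV2 ?posrE// ler_nat ltnS.
    exact: leq_maxr.
  have ql := sqsem_add sq (l - y n) (y n); rewrite subrK in ql.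
  have qln := qB (l - y n).
  suff Bln : B * rnorm (l - y n) ^+ 2 <= e / 4.
    have := le_trans qln Bln.
    by move: qn e4 ql; move: (q _) (q _) (q _) (_^-1) => *; lra.
  rewrite (le_trans (y := (B + 1) * rnorm (l - y n) ^+ 2))//.
    by rewrite ler_wpM2r ?sqr_ge0// lerDl.
  rewrite (le_trans (y := (B + 1) * (e / (4 * (B + 1)))))//.
    by rewrite ler_wpM2l// ltW.
  by rewrite (mulrC 4) invfM mulrCA mulVKf ?gt_eqF.
have l0 := q_inj _ Ml ql.
have : rnorm (1 : K) <= 0.
  apply/unstable.ler_gtP => e e0.
  have z0 : 0 < rnorm z + 1 by rewrite ltr_wpDl ?rnorm_ge0.
  have [|N HN] := lP (e / (rnorm z + 1)); first by rewrite divr_gt0.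
  have [_ <- _] := yP N.
  have := HN N (leqnn _); rewrite l0 sub0r rnormN => /ltW yN.
  rewrite (le_trans (cauchy_schwarz norm_dot _ _))//.
  rewrite (le_trans (y := e / (rnorm z + 1) * (rnorm z + 1)))//.
    by rewrite ler_pM ?rnorm_ge0// lerDl.
  by rewrite divfK// gt_eqF.
by rewrite rnorm1 ler10.
Qed.

(** The terms are removed one at a time, the seminorm at each stage being [q]
    plus the remaining terms; it vanishes only where [q] does. *)
Lemma bounded_below_drop_functionals (M : set H) (q : H -> R) (z : nat -> H)
    (N : nat) (c : R) :
  closed_subspace M -> square_seminorm q ->
  (forall x, M x -> q x = 0 -> x = 0) ->
  0 < c ->
  (forall x, M x ->
     c * rnorm x ^+ 2 <= q x + \sum_(0 <= k < N) rnorm (dot x (z k)) ^+ 2) ->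
  exists2 c', 0 < c' & forall x, M x -> c' * rnorm x ^+ 2 <= q x.
Proof.
move=> csM sq q_inj; elim: N c => [|N IH] c c0 cM.
  by exists c => // x /cM; rewrite big_geq// addr0.
pose p x := q x + \sum_(0 <= k < N) rnorm (dot x (z k)) ^+ 2.
have sp : square_seminorm p.
  rewrite /p; elim: N {IH cM p} => [|N IH].
    by under eq_fun do rewrite big_geq// addr0.
  under eq_fun do rewrite big_nat_recr//= addrA.
  exact: square_seminormD IH (square_seminorm_dot _).
have p_inj x : M x -> p x = 0 -> x = 0.
  move=> Mx px0; apply: q_inj => //; apply/le_anti.
  by rewrite (sqsem_ge0 sq) andbT -px0 lerDl sumr_ge0// => k _; exact: sqr_ge0.
have pM x : M x -> c * rnorm x ^+ 2 <= p x + rnorm (dot x (z N)) ^+ 2.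
  by move=> Mx; have := cM x Mx; rewrite big_nat_recr//= addrA.
have [c' c'0 c'M] := bounded_below_drop_functional csM sp p_inj c0 pM.
exact: IH c'0 c'M.
Qed.

End DropFunctionals.

(** * Frame sums and perturbations *)

Section FrameSums.
Context (R : realType) (s : scalar_kind).
Notation K := (scalar_field R s).
Context (H : normedModType K) (dot : {dot H for scalar_conj R s}).
Context (norm_dot : forall x : H, `|x| ^+ 2 = dot x x).
Implicit Types (f g h : nat -> H) (x y : H).

Let term_ge0 f x k : (0 <= (rnorm (dot x (f k)) ^+ 2)%:E)%E.
Proof. by rewrite lee_fin sqr_ge0. Qed.

Lemma frame_sum_ge0 f x : (0 <= frame_sum dot f x)%E.
Proof. exact: nneseries_ge0. Qed.

(** The weighted form, with [t] free, replaces the triangle inequality in l2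
    and can be made as sharp by the choice of [t]. *)
Lemma frame_sum_convex (t : R) f g h x : 0 < t < 1 ->
  (forall k,
     rnorm (dot x (f k)) <= rnorm (dot x (g k)) + rnorm (dot x (h k))) ->
  (frame_sum dot f x <=
     ((1 - t)^-1)%:E * frame_sum dot g x + (t^-1)%:E * frame_sum dot h x)%E.
Proof.
by move=> t01; apply: sqr_series_le_convex => // k; exact: rnorm_ge0.
Qed.

(** The real counterpart of [frame_sum]; the two agree for Bessel sequences. *)
Definition energy f x : R := fine (frame_sum dot f x).

Lemma energy_ge0 f x : 0 <= energy f x.
Proof. exact/fine_ge0/frame_sum_ge0. Qed.

Section Bessel.
Context (f : nat -> H) (B : R).
Hypothesis fB : upper_frame_bound dot setT f B.

Lemma frame_sum_energy x : frame_sum dot f x = (energy f x)%:E.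
Proof.
rewrite /energy fineK// ge0_fin_numE ?frame_sum_ge0//.
by rewrite (le_lt_trans (fB.2 x I))// ltry.
Qed.

Lemma energy_le x : energy f x <= B * rnorm x ^+ 2.
Proof. by rewrite -lee_fin -frame_sum_energy; exact: fB.2. Qed.

Lemma square_seminorm_energy : square_seminorm (energy f).
Proof.
split=> [x|x y|a x|].
- exact: energy_ge0.
- rewrite -lee_fin EFinD !EFinM -!frame_sum_energy.
  have h2 : 0 < (2^-1 : R) < 1 by lra.
  have := @sqr_series_le_convex R 2^-1 (fun k => rnorm (dot (x + y) (f k)))
    (fun k => rnorm (dot x (f k))) (fun k => rnorm (dot y (f k))) h2.
  have -> : 1 - 2^-1 = 2^-1 :> R by lra.
  rewrite invrK; apply => k; first exact: rnorm_ge0.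
  by rewrite dotDl ler_rnormD.
- apply: EFin_inj; rewrite EFinM -!frame_sum_energy /frame_sum -nneseriesZl//.
  apply: eq_eseriesr => k _.
  by rewrite dotZl rnormM exprMn EFinM.
- by exists B; [exact: ltW fB.1 | exact: energy_le].
Qed.

Lemma energy_eq0 x : energy f x = 0 -> forall k, dot x (f k) = 0.
Proof.
move=> fx k; apply/(@rnorm0_eq0 R s)/eqP; rewrite -sqrf_eq0; apply/eqP.
apply/le_anti; rewrite sqr_ge0 andbT -fx -lee_fin -frame_sum_energy.
have /(_ 0%N k.+1) := @nneseries_lim_ge R _ xpredT _ _
  (fun k _ _ => term_ge0 f x k).
by apply: le_trans; rewrite big_nat_recr//= leeDr// sume_ge0.
Qed.

End Bessel.

(** Says that the finite truncations of the analysis operator of [h] converge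
    to it in operator norm; in particular that operator is compact. *)
Definition vanishing_tails h : Prop :=
  forall e : R, 0 < e -> exists N, forall x,
    (frame_sum dot h x <=
       (\sum_(0 <= k < N) rnorm (dot x (h k)) ^+ 2 + e * rnorm x ^+ 2)%:E)%E.

Lemma geometric_frame_sum_le (mu r : R) h N x : 0 <= mu < 1 ->
  (forall k, rnorm (h k) <= mu ^+ k * r) ->
  (frame_sum dot h x <=
     (\sum_(0 <= k < N) rnorm (dot x (h k)) ^+ 2 +
      (mu ^+ N) ^+ 2 * (r ^+ 2 / (1 - mu ^+ 2)) * rnorm x ^+ 2)%:E)%E.
Proof.
move=> mu01 hr; apply: sqr_series_le => n.
have Nn := leq_maxl N n; have nn := leq_maxr N n.
rewrite (le_trans (y := \sum_(0 <= k < maxn N n) rnorm (dot x (h k)) ^+ 2))//.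
  rewrite [leRHS](big_cat_nat (n := n))//= lerDl sumr_ge0// => k _.
  exact: sqr_ge0.
rewrite (big_cat_nat (n := N))//= lerD2l.
rewrite (le_trans (y :=
    \sum_(N <= k < maxn N n) (mu ^+ k * r) ^+ 2 * rnorm x ^+ 2))//.
  apply: ler_sum => k _; rewrite (le_trans (sqr_cauchy_schwarz norm_dot _ _))//.
  rewrite ler_wpM2r ?sqr_ge0// lerXn2r ?nnegrE ?rnorm_ge0//.
  by rewrite (le_trans _ (hr k)) ?rnorm_ge0.
by rewrite -mulr_suml ler_wpM2r ?sqr_ge0// sqr_geometric_le.
Qed.

Lemma geometric_vanishing_tails (mu r : R) h : 0 <= mu < 1 ->
  (forall k, rnorm (h k) <= mu ^+ k * r) -> vanishing_tails h.
Proof.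
move=> mu01 hr e e0; have /andP[mu0 mu1] := mu01.
have rho0 : 0 <= r ^+ 2 / (1 - mu ^+ 2).
  by rewrite divr_ge0 ?sqr_ge0// subr_ge0 exprn_ile1// ltW.
set rho := r ^+ 2 / _ in rho0.
have rho1 : 0 < rho + 1 by rewrite ltr_wpDl.
have mu_lt1 : `|mu| < 1 by rewrite ger0_norm.
have d0 : 0 < e / (rho + 1) by rewrite divr_gt0.
have /cvgrPdist_lt/(_ _ d0)[N _ HN] := cvg_expr mu_lt1.
exists N => x; apply: (le_trans (geometric_frame_sum_le N x mu01 hr)).
rewrite lee_fin lerD2l ler_wpM2r ?sqr_ge0// -/rho.
have muN0 : 0 <= mu ^+ N by rewrite exprn_ge0.
have muN1 : mu ^+ N <= 1 by rewrite exprn_ile1// ltW.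
have muNd : mu ^+ N <= e / (rho + 1).
  by have /ltW := HN N (leqnn N); rewrite sub0r normrN ger0_norm.
rewrite (le_trans (y := e / (rho + 1) * (rho + 1)))//; last first.
  by rewrite divfK// gt_eqF.
rewrite ler_pM ?sqr_ge0 ?lerDl//.
by rewrite (le_trans _ muNd)// expr2 -[leRHS]mulr1 ler_wpM2l.
Qed.

Lemma upper_frame_bound_add f g h (B C : R) :
  (forall k, g k = f k + h k) ->
  upper_frame_bound dot setT f B -> 0 <= C ->
  (forall x, (frame_sum dot h x <= (C * rnorm x ^+ 2)%:E)%E) ->
  upper_frame_bound dot setT g (2 * B + 2 * C).
Proof.
move=> gfh [B0 fB] C0 hC; split; first by rewrite ltr_wpDr ?mulr_ge0 ?mulr_gt0.
move=> x _; have h2 : 0 < (2^-1 : R) < 1 by lra.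
apply: (le_trans (frame_sum_convex (f := g) (g := f) (h := h) h2 _)).
  by move=> k; rewrite gfh dotDr ler_rnormD.
have -> : 1 - 2^-1 = 2^-1 :> R by lra.
rewrite invrK mulrDl -!mulrA [leRHS]EFinD.
have double (S : \bar R) (r : R) : (S <= r%:E -> 2%:E * S <= (2 * r)%:E)%E.
  by move=> Sr; rewrite EFinM lee_wpmul2l// lee_fin.
by apply: leeD; apply: double; [exact: fB | exact: hC].
Qed.

Lemma lower_frame_sum_add (t : R) f g h x : 0 < t < 1 ->
  (forall k, g k = f k + h k) ->
  (frame_sum dot f x <=
     ((1 - t)^-1)%:E * frame_sum dot g x + (t^-1)%:E * frame_sum dot h x)%E.
Proof.
move=> t01 gfh; apply: frame_sum_convex => // k.
have -> : dot x (f k) = dot x (g k) - dot x (h k).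
  by rewrite gfh dotDr addrK.
exact: ler_rnormB.
Qed.

(** With [S] denoting frame sums, [A |x|^2 <= S f <= S g / (1 - t) + S h / t],
    so [(1 - t) (A - C / t)] is a lower bound for [g] whenever it is positive,
    that is for every [t] strictly between [C / A] and 1. *)
Lemma frame_small_perturbation f g h (A C : R) :
  (forall k, g k = f k + h k) -> frame dot setT f ->
  lower_frame_bound dot setT f A -> 0 <= C -> C < A ->
  (forall x, (frame_sum dot h x <= (C * rnorm x ^+ 2)%:E)%E) ->
  frame dot setT g.
Proof.
move=> gfh [_ [_ [B [_ fB]]]] [A0 fA] C0 CA hC; split => //.
have gB := upper_frame_bound_add gfh fB C0 hC.
(* The midpoint of C / A and 1. *)
pose t := (A + C) / (2 * A).
have t0 : 0 < t by rewrite divr_gt0 ?mulr_gt0// ltr_wpDr.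
have t1 : t < 1 by rewrite ltr_pdivrMr ?mulr_gt0//; lra.
have Ct : C / t < A.
  have At : A * t = (A + C) / 2 by rewrite /t; field; rewrite gt_eqF.
  by rewrite ltr_pdivrMr// At; lra.
exists ((1 - t) * (A - C / t)), (2 * B + 2 * C); split=> //; split.
  by rewrite mulr_gt0// subr_gt0.
move=> x _; rewrite (frame_sum_energy gB) lee_fin.
have t01 : 0 < t < 1 by rewrite t0.
have := le_trans (fA x I) (lower_frame_sum_add x t01 gfh).
have := lee_wpmul2l (x := (t^-1)%:E) _ (hC x).
rewrite lee_fin invr_ge0 ltW// => /(_ isT) hCt.
move=> /le_trans/(_ (leeD2l _ hCt)).
rewrite (frame_sum_energy gB) -!EFinM -EFinD lee_fin => AgC.
rewrite -mulrA -ler_pdivlMl ?subr_gt0// mulrBl.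
rewrite lerBlDr (le_trans AgC)// lerD2l le_eqVlt; apply/orP; left; apply/eqP.
by rewrite mulrCA mulrA.
Qed.

End FrameSums.

Section FrameSequence.
Context (R : realType) (s : scalar_kind).
Notation K := (scalar_field R s).
Context (H : completeNormedModType K) (dot : {dot H for scalar_conj R s}).
Context (norm_dot : forall x : H, `|x| ^+ 2 = dot x x).
Implicit Types (f g h : nat -> H) (x y : H).

Lemma linear_span_mem f k : linear_span f (f k).
Proof.
exists k.+1, (fun i => (i == ord_max)%:R).
rewrite (bigD1 ord_max)//= eqxx scale1r big1 ?addr0// => i /negPf ->.
by rewrite scale0r.
Qed.

(** A compact perturbation of a frame is a frame sequence. Choosing [N] so that
    the tail of [h] beyond [N] costs at most a quarter of [A], the inequality
    [A |x|^2 <= 2 S g + 2 S h] leaves [A / 4 |x|^2] below [S g] plus the first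
    [N] squares [|<x, h k>|^2]. Those finitely many functionals can be dropped
    on a closed subspace on which [S g] vanishes only at 0. The orthogonal
    complement of the zero set of [S g] is such a subspace, and it contains
    the closed span of [g]. *)
Lemma frame_sequence_perturbation f g h (A B : R) :
  (forall k, g k = f k + h k) ->
  lower_frame_bound dot setT f A ->
  upper_frame_bound dot setT g B -> vanishing_tails dot h ->
  frame_sequence dot g.
Proof.
move=> gfh [A0 fA] gB hN.
split; first by move=> k; apply/subset_closure/linear_span_mem.
have A4 : 0 < A / 4 by rewrite divr_gt0.
have [N HN] := hN _ A4.
pose q := energy dot g.
pose M := dot_perp dot [set x | q x = 0].
have sq : square_seminorm q := square_seminorm_energy gB.
have csM : closed_subspace M.
  split=> [x y|a x|x]; [exact: dot_perpB | exact: dot_perpZ |].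
  exact: dot_perp_approx.
have q_inj x : M x -> q x = 0 -> x = 0.
  move=> Mx /Mx xx; apply/normr0_eq0/eqP; rewrite -sqrf_eq0 norm_dot.
  exact/eqP.
have qN x : M x -> A / 4 * rnorm x ^+ 2 <=
    q x + \sum_(0 <= k < N) rnorm (dot x (h k)) ^+ 2.
  move=> _; have h2 : 0 < (2^-1 : R) < 1 by lra.
  have := le_trans (fA x I) (lower_frame_sum_add dot x h2 gfh).
  have := lee_wpmul2l (x := (2^-1^-1 : R)%:E) _ (HN x).
  rewrite lee_fin invr_ge0 invr_ge0 ler0n => /(_ isT) hCt.
  move=> /le_trans/(_ (leeD2l _ hCt)).
  have -> : 1 - 2^-1 = 2^-1 :> R by lra.
  rewrite (frame_sum_energy gB) -!EFinM -EFinD lee_fin invrK -/(q x).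
  by move: (\sum_(_ <= _ < _) _) (rnorm x ^+ 2) (q x) => *; lra.
have [c c0 cM] := bounded_below_drop_functionals norm_dot csM sq q_inj A4 qN.
exists c, B; split; split => //; [|exact: gB.1 | by move=> x _; exact: gB.2].
move=> x gx; rewrite (frame_sum_energy gB) lee_fin; apply: cM.
apply: (closure_span_perp norm_dot _ gx) => z qz k.
by apply: (energy_eq0 gB); exact: qz.
Qed.

End FrameSequence.

(** * Perturbed operator orbits *)

Unset Implicit Arguments.

Theorem proposition3p3 (R : realType) (s : scalar_kind)
    (H : completeNormedModType (scalar_field R s))
    (dot : {dot H for scalar_conj R s})
    (norm_dot : forall x : H, `|x| ^+ 2 = dot x x)
    (H_separable : separable H)
    (T : {linear H -> H}) (T_bounded : bounded_operator T)
    (phi : H) (phi_frame : frame dot setT (fun n => iter n T phi))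
    (A : R) (A_bound : lower_frame_bound dot setT (fun n => iter n T phi) A)
    (V : set H) (V_invariant : T @` V `<=` V)
    (mu : R) (mu_ge0 : 0 <= mu) (mu_lt1 : mu < 1)
    (T_contract : forall psi : H, V psi -> rnorm (T psi) <= mu * rnorm psi) :
  (forall psi : H, V psi ->
     frame_sequence dot (fun n => iter n T (phi + psi))) /\
  (forall psi : H, V psi -> rnorm psi < Num.sqrt (A * (1 - mu ^+ 2)) ->
     frame dot setT (fun n => iter n T (phi + psi))).
Proof.

have mu01 : 0 <= mu < 1 by rewrite mu_ge0.
pose f n := iter n T phi.
pose h psi n := iter n T psi.
have iterD psi n : iter n T (phi + psi) = f n + h psi n.
  rewrite /f /h.
  by elim: n => //= n ->; rewrite raddfD.
have V_iter psi n : V psi -> V (iter n T psi).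
  by move=> Vpsi; elim: n => //= n IH; apply: V_invariant;
    exists (iter n T psi).
have decay psi : V psi -> forall n, rnorm (iter n T psi) <= mu ^+ n * rnorm psi.
  move=> Vpsi; elim=> [|n IH] /=; first by rewrite mul1r.
  rewrite exprS -mulrA (le_trans (T_contract _ (V_iter _ n Vpsi)))//.
  by rewrite ler_wpM2l.
have d0 : 0 < 1 - mu ^+ 2 by rewrite subr_gt0 expr_lt1.
pose C (psi : H) : R := rnorm psi ^+ 2 / (1 - mu ^+ 2).
have C0 psi : 0 <= C psi by rewrite divr_ge0 ?sqr_ge0// ltW.
have hC psi : V psi -> forall x,
    (frame_sum dot (h psi) x <= (C psi * rnorm x ^+ 2)%:E)%E.
  move=> Vpsi x.
  (* With N = 0 the whole series is treated as the tail. *)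
  have := geometric_frame_sum_le norm_dot 0 x mu01 (decay _ Vpsi).
  by rewrite big_geq// add0r expr0 expr1n mul1r.
split=> psi Vpsi.
  have [_ [_ [B [_ phiB]]]] := phi_frame.
  apply: (frame_sequence_perturbation (f := f) (h := h psi) norm_dot (iterD psi)
    A_bound).
    exact: upper_frame_bound_add (iterD psi) phiB (C0 psi) (hC _ Vpsi).
  exact: (geometric_vanishing_tails (h := h psi) norm_dot mu01 (decay _ Vpsi)).
move=> psi_small.
apply: (frame_small_perturbation (iterD psi) phi_frame A_bound (C0 psi) _
  (hC _ Vpsi)).
have A0 := A_bound.1.
rewrite /C ltr_pdivrMr// -[ltRHS]sqr_sqrtr ?mulr_ge0 ?ltW//.
by rewrite ltrXn2r ?nnegrE ?rnorm_ge0 ?sqrtr_ge0.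
Qed.
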